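(* Let $m\ge2$ and $\xi\in\Xi_{2,m}$. The subshift over the alphabet $\mathcal{A}=\{a\}\cup\{\alpha_\phi:\phi\in\mathrm{Epi}(B,A)\}$ associated with the spinal group $G_\xi$ is an aperiodic simple Toeplitz subshift.
   Context: Spinal groups on the binary tree. Let $A=\mathbb{Z}/2\mathbb{Z}$, $B=(\mathbb{Z}/2\mathbb{Z})^m$, and let $\mathrm{Epi}(B,A)$ be the set of surjective homomorphisms $B\to A$. $\Xi_{2,m}$ is the set of sequences $\xi=(\xi_1,\xi_2,\ldots)\in\mathrm{Epi}(B,A)^{\mathbb{N}}$ such that $\bigcap_{j\ge i}\mathrm{Ker}(\xi_j)=\{0\}$ for every $i$. Let $T_2$ be the infinite binary rooted tree, with vertices the finite words over $\{0,1\}$ and boundary $\partial T_2=\{0,1\}^{\mathbb{N}}$. The automorphism $a$ of $T_2$ changes the first letter: $a(0w)=1w$, $a(1w)=0w$. For $b\in B$ the automorphism $b_\xi$ fixes the rightmost ray $1^\infty$ and satisfies $b_\xi(1^{r-1}0w)=1^{r-1}0\,a^{\xi_r(b)}(w)$ for $r\ge1$. Put $B_\xi=\{b_\xi:b\in B\}$ (isomorphic to $B$) and let $G_\xi\le\mathrm{Aut}(T_2)$ be the group generated by $a$ and $B_\xi$, with generating set $S_\xi=\{a\}\cup B_\xi\setminus\{\mathrm{id}\}$. It acts also on $\partial T_2$. The associated subshift. Consider the Schreier graph of the action of $G_\xi$ on the orbit of $1^\infty\in\partial T_2$ (vertices: points of the orbit; an edge labelled $s$ from $x$ to $sx$ for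 each $s\in S_\xi$). Up to loops and multiple edges it is a half-line with end vertex $1^\infty$: put $x_1=1^\infty$, $x_2=a x_1$, and for $i\ge2$ let $x_{i+1}$ be the unique neighbour of $x_i$ different from $x_i$ and $x_{i-1}$. Let $\eta$ be the one-sided infinite word over $\mathcal{A}$ whose $i$-th letter is $a$ if $x_{i+1}=ax_i$, and is $\alpha_\phi$ if the set of $b\in B$ with $b_\xi x_i=x_{i+1}$ equals $B\setminus\mathrm{Ker}(\phi)$. The subshift associated with $G_\xi$ is the set of all $\omega\in\mathcal{A}^{\mathbb{Z}}$ such that every finite word occurring in $\omega$ occurs in $\eta$, with the shift $(T\omega)(n)=\omega(n+1)$. Simple Toeplitz subshifts. Let $\mathcal{A}$ be a finite alphabet, $(a_k)_{k\ge0}$ a sequence in $\mathcal{A}$ and $(n_k)_{k\ge0}$ a sequence of integers with $n_k\ge2$. The eventual alphabet $\widetilde{\mathcal{A}}$ is the set of letters occurring infinitely often in $(a_k)$; it is assumed that $\#\widetilde{\mathcal{A}}\ge2$ and $a_{k+1}\ne a_k$ for all $k$. Define $p^{(-1)}=\epsilon$ (empty word) and $p^{(k+1)}=p^{(k)}a_{k+1}p^{(k)}\ldots p^{(k)}a_{k+1}p^{(k)}$ with exactly $n_{k+1}$ blocks $p^{(k)}$ and $n_{k+1}-1$ letters $a_{k+1}$, and $p^{(\infty)}=\lim_kp^{(k)}$. The simple Toeplitz subshift with these coding sequences is the set of all $\omega\in\mathcal{A}^{\mathbb{Z}}$ such that every finite word occurring in $\omega$ occurs in $p^{(\infty)}$.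 A subshift is aperiodic if it contains no $\omega$ with $T^P\omega=\omega$ for some $P\ge1$. *)

(* Defs.v *)
From mathcomp Require Import all_boot all_order all_algebra.
From mathcomp Require Import boolp classical_sets.

Set Implicit Arguments.
Unset Strict Implicit.
Unset Printing Implicit Defensive.

Import GRing.Theory.
Local Open Scope classical_set_scope.
Local Open Scope ring_scope.

Section Subshifts.
Variable L : Type.

Definition factor1 (u : nat -> L) (w : seq L) : Prop :=
  exists p : nat, w = mkseq (fun i => u (p + i)%N) (size w).

Definition factor2 (omega : int -> L) (w : seq L) : Prop :=
  exists p : int, w = mkseq (fun i => omega (p + i%:Z)) (size w).

Definition subshift_of (u : nat -> L) : set (int -> L) :=
  [set omega | forall w, factor2 omega w -> factor1 u w].

Definition shift (omega : int -> L) : int -> L := fun n => omega (n + 1).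

Definition aperiodic (X : set (int -> L)) : Prop :=
  ~ exists omega P, [/\ X omega, (1 <= P)%N & iter P shift omega = omega].

End Subshifts.

Section SimpleToeplitz.
Variable L : finType.
Variables (a : nat -> L) (n : nat -> nat).

(* p l p l ... l p with [k] blocks [p] and [k.-1] letters [l] (for [k >= 1]) *)
Definition spaced (l : L) (k : nat) (p : seq L) : seq L :=
  iter k.-1 (fun w => p ++ l :: w) p.

(* [toeplitz_prefix k] is p^(k-1), so that [toeplitz_prefix 0] is the empty
   word p^(-1). *)
Fixpoint toeplitz_prefix (k : nat) : seq L :=
  if k is k'.+1 then spaced (a k') (n k') (toeplitz_prefix k') else [::].

(* The limit of the p^(k): if all [n k] are at least 2, then p^(i) has more
   than [i] letters, so that the default value of [nth] is never used; see
   [toeplitz_wordP]. *)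
Definition toeplitz_word (i : nat) : L := nth (a 0%N) (toeplitz_prefix i.+1) i.

Definition eventual_alphabet : pred L :=
  [pred l | `[< forall N : nat, exists2 k : nat, (N <= k)%N & a k = l >]].

Definition toeplitz_coding : Prop :=
  [/\ forall k, (2 <= n k)%N,
      (2 <= #|eventual_alphabet|)%N
    & forall k, a k.+1 <> a k].

Lemma size_toeplitz_prefix k :
  (forall j, (2 <= n j)%N) -> (k <= size (toeplitz_prefix k))%N.
Proof.
move=> n_ge2; elim: k => //= k IHk; rewrite /spaced.
have := n_ge2 k; case: (n k) => [|[|j]] //= _.
by rewrite size_cat /= addnS ltnS (leq_trans IHk) ?leq_addr.
Qed.

Lemma toeplitz_prefixS k : prefix (toeplitz_prefix k) (toeplitz_prefix k.+1).
Proof.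
by rewrite /= /spaced; case: (n k).-1 => [|j] /=; rewrite ?prefix_refl ?prefix_prefix.
Qed.

Lemma toeplitz_wordP : (forall j, (2 <= n j)%N) ->
  forall k, toeplitz_prefix k = mkseq toeplitz_word (size (toeplitz_prefix k)).
Proof.
move=> n_ge2.
have pre k d : prefix (toeplitz_prefix k) (toeplitz_prefix (d + k)).
  elim: d => [|d IHd]; first exact: prefix_refl.
  exact: prefix_trans IHd (toeplitz_prefixS _).
have nthE j k i : (i < size (toeplitz_prefix j))%N -> (j <= k)%N ->
    nth (a 0%N) (toeplitz_prefix k) i = nth (a 0%N) (toeplitz_prefix j) i.
  move=> lti /subnK <-; have /prefixP[s ->] := pre j (k - j)%N.
  by rewrite nth_cat lti.
move=> k; apply: (@eq_from_nth _ (a 0%N)); rewrite ?size_mkseq // => i lti.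
rewrite nth_mkseq // /toeplitz_word.
have lti' := size_toeplitz_prefix i.+1 n_ge2.
by case/orP: (leq_total k i.+1) => le; rewrite (nthE _ _ _ _ le).
Qed.

End SimpleToeplitz.

Definition simple_toeplitz (L : finType) (X : set (int -> L)) : Prop :=
  exists a n, toeplitz_coding a n /\ X = subshift_of (toeplitz_word a n).

(* The letters 0 and 1 are [false] and [true]. *)
Local Notation vertex := (seq bool).
Local Notation boundary := (nat -> bool).

Definition tree_aut : set (vertex -> vertex) :=
  [set g | [/\ bijective g, forall v, size (g v) = size v
             & forall k v, g (take k v) = take k (g v)]].

Definition bd_act (g : vertex -> vertex) (x : boundary) : boundary :=
  fun k => nth false (g (mkseq x k.+1)) k.

Inductive generated (S : set (vertex -> vertex)) : set (vertex -> vertex) :=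
| generated_id : generated S id
| generated_in g : S g -> generated S g
| generated_comp g h : generated S g -> generated S h -> generated S (g \o h)
| generated_inv g h :
    generated S g -> cancel g h -> cancel h g -> generated S h.

Definition ones : boundary := fun=> true.

Local Notation A := 'Z_2.
Local Notation B m := 'rV['Z_2]_m.

Definition is_epi m (phi : {ffun B m -> A}) : bool :=
  [forall x, forall y, phi (x + y) == phi x + phi y]
  && [forall c, exists x, phi x == c].

Definition Epi (m : nat) : Type := {phi : {ffun B m -> A} | is_epi phi}.

Definition epi_fun m (phi : Epi m) : B m -> A := val phi.
Coercion epi_fun : Epi >-> Funclass.

(* Sequences are indexed from 0: [xi r] is the (r+1)-st term. *)
Definition Xi m (xi : nat -> Epi m) : Prop :=
  forall i : nat, \bigcap_(j in [set j | (i <= j)%N]) [set b | xi j b = 0]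
                  = [set 0].

Definition aut_a (v : vertex) : vertex :=
  if v is c :: w then ~~ c :: w else [::].

Section Spinal.
Variable m : nat.
Implicit Types (xi : nat -> Epi m) (b : B m).

(* The element [xi 0 b] of Z/2 is used as an exponent through the coercion of
   ordinals to nat; see [aut_b_ones] and [aut_bE] for the usual description. *)
Fixpoint aut_b xi b (v : vertex) : vertex :=
  match v with
  | [::] => [::]
  | true :: w => true :: aut_b (fun r => xi r.+1) b w
  | false :: w => false :: iter (xi 0%N b) aut_a w
  end.

Lemma aut_b_ones xi b r : aut_b xi b (nseq r true) = nseq r true.
Proof. by elim: r xi => //= r IHr xi; rewrite IHr. Qed.

Lemma aut_bE xi b r w :
  aut_b xi b (nseq r true ++ false :: w)
  = nseq r true ++ false :: iter (xi r b) aut_a w.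
Proof. by elim: r xi => //= r IHr xi; rewrite IHr. Qed.

Definition spinal_group xi : set (vertex -> vertex) :=
  generated ([set aut_a] `|` range (aut_b xi)).

Definition spinal_gens xi : set (vertex -> vertex) :=
  [set aut_a] `|` (range (aut_b xi) `\ id).

Lemma aut_a_tree : tree_aut aut_a.
Proof.
split; first by exists aut_a => -[|c w] //=; rewrite negbK.
  by case.
by case=> [|k] [|c w].
Qed.

Lemma iter_aut_aK k : cancel (iter k aut_a) (iter k aut_a).
Proof.
have aK : involutive aut_a by case=> [|c w] //=; rewrite negbK.
by elim: k => // k IHk v; rewrite iterSr iterS aK IHk.
Qed.

Lemma aut_b_tree xi b : tree_aut (aut_b xi b).
Proof.
have [_ sa ta] := aut_a_tree.
have si k v : size (iter k aut_a v) = size v by elim: k => //= k <-.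
have ti k j v : iter k aut_a (take j v) = take j (iter k aut_a v).
  by elim: k => //= k ->.
split.
- have bK : cancel (aut_b xi b) (aut_b xi b).
    by move=> v; elim: v xi => [|[] w IHw] xi //=; rewrite ?IHw ?iter_aut_aK.
  by exists (aut_b xi b).
- by move=> v; elim: v xi => [|[] w IHw] xi //=; rewrite ?IHw ?si.
- move=> k v; elim: v k xi => [|[] w IHw] [|k] xi //=; first by rewrite IHw.
  by rewrite ti.
Qed.

Lemma spinal_group_tree_aut xi : spinal_group xi `<=` tree_aut.
Proof.
move=> g; elim=> {g} [|g [->|[b _ <-]]|g h _ [bg sg tg] _ [bh sh th]
                      |g h _ [bg sg tg] gK hK].
- by split=> //; exists id.
- exact: aut_a_tree.
- exact: aut_b_tree.
- split=> [|v|k v] /=; [exact: bij_comp | by rewrite sg | by rewrite th tg].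
- split=> [|v|k v]; first by exists g.
    by rewrite -sg hK.
  by apply: (can_inj gK); rewrite hK tg hK.
Qed.

Definition orbit_ones xi : set boundary :=
  [set x | exists2 g, spinal_group xi g & x = bd_act g ones].

Definition schreier_edge xi (s : vertex -> vertex) (x y : boundary) : Prop :=
  [/\ orbit_ones xi x, spinal_gens xi s & y = bd_act s x].

(* The generators are involutions, so this relation is symmetric. *)
Definition neighbour xi (x y : boundary) : Prop :=
  exists s, schreier_edge xi s x y.

(* [x 0], [x 1], ... are the points x_1, x_2, ... *)
Definition schreier_ray xi (x : nat -> boundary) : Prop :=
  [/\ x 0%N = ones, x 1%N = bd_act aut_a (x 0%N)
    & forall i y, y = x i.+2 <->
        [/\ neighbour xi (x i.+1) y, y <> x i.+1 & y <> x i]].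

(* The alphabet: [None] is the letter a and [Some phi] is alpha_phi. *)
Definition letter : Type := option (Epi m).

Definition schreier_word xi (eta : nat -> letter) : Prop :=
  exists2 x, schreier_ray xi x
  & forall i,
      (eta i = None <-> x i.+1 = bd_act aut_a (x i))
      /\ forall phi : Epi m, eta i = Some phi <->
           [set b | bd_act (aut_b xi b) (x i) = x i.+1]
           = ~` [set b | phi b = 0].

Lemma schreier_word_uniq xi eta eta' :
  schreier_word xi eta -> schreier_word xi eta' -> eta = eta'.
Proof.
move=> [x [x0 x1 xS] etaE] [x' [x0' x1' xS'] etaE'].
have xx' i : x i = x' i /\ x i.+1 = x' i.+1.
  elim: i => [|i [e e1]]; first by rewrite x1 x1' x0 x0'.
  split=> //; apply/(xS' i); rewrite -e -e1; exact/xS.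
apply: funext => i; have [e e1] := xx' i.
have := etaE i; have := etaE' i; rewrite -e -e1 => -[n' s'] [n s].
case E: (eta i) => [phi|]; last by symmetry; apply/n'/n.
by symmetry; apply/s'/s.
Qed.

(* The default value a^oo of [xget], which would be used if there were no
   Schreier word, would yield a periodic subshift. *)
Definition spinal_word xi : nat -> letter := xget (fun=> None) (schreier_word xi).

Definition spinal_subshift xi : set (int -> letter) := subshift_of (spinal_word xi).

End Spinal.

(* Main.v *)
Require Import Defs.
From mathcomp Require Import all_boot all_algebra.
From mathcomp Require Import boolp classical_sets zify.

(** Reading 1 as the bit 0, the points [x_i] of the Schreier ray run through
    the reflected binary Gray code: the step from [i] to [i + 1] flips the bit
    number [v], the 2-adic valuation of [i + 1]; for [v = 0] this is the action
    of [a], and otherwise the first 0 of [x_i] is in position [v - 1], so that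
    the flip is made by the elements [b] with [xi_v(b) <> 0].  Hence the letters
    of the word are [u (v_2 (i + 1))], where [u] is the sequence
    [a, alpha_(xi_1), alpha_(xi_2), ...].  This is the Toeplitz word with
    letters [u] and all [n_k = 2]; merging each maximal run of [d] equal letters
    into one letter with [n_k = 2 ^ d] yields a coding sequence without equal
    neighbours.  It has at least two recurrent letters since
    [xi] is not eventually constant: a single epimorphism has a nontrivial
    kernel when [m >= 2].  Finally, a period [P] of a limit word would give
    [u t = u (v_2 P)] for all [t > v_2 P]. *)

Set Implicit Arguments.
Unset Strict Implicit.
Unset Printing Implicit Defensive.

Import GRing.Theory.

(** Once [p ^ v] is factored out of the sum, the cofactor [z * p + q] is still coprime to [p]. *)
Lemma logn_addl_lt p x y : prime p -> 0 < x -> 0 < y ->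
  logn p y < logn p x -> logn p (x + y) = logn p y.
Proof.
move=> p_pr x0 y0 lt_yx.
have [q q_co qE] := pfactor_coprime p_pr y0.
have /dvdnP[z xE] : p ^ (logn p y).+1 %| x by rewrite pfactor_dvdn.
set v := logn p y in lt_yx qE xE *.
have -> : x + y = (z * p + q) * p ^ v by rewrite qE xE expnS mulnA mulnDl.
have co : coprime p (z * p + q) by rewrite /coprime gcdnMDl.
have zq0 : 0 < z * p + q.
  by rewrite lt0n; apply: contraL co => /eqP->; rewrite /coprime gcdn0 gtn_eqF ?prime_gt1.
have pv0 : 0 < p ^ v by rewrite expn_gt0 prime_gt0.
by rewrite lognM // pfactorK // logn_coprime.
Qed.

(** * Ruler words as Toeplitz words *)

Section Ruler.
Variable L : finType.
Implicit Types u : nat -> L.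

Definition ruler u (i : nat) : L := u (logn 2 i.+1).

(** Adding [2 ^ k] preserves the valuation of every positive number below [2 ^ k], so the word
    repeats after its letter [u k]. *)
Lemma ruler_mkseqS u k :
  mkseq (ruler u) (2 ^ k.+1).-1 =
  mkseq (ruler u) (2 ^ k).-1 ++ u k :: mkseq (ruler u) (2 ^ k).-1.
Proof.
have k0 : 0 < 2 ^ k by rewrite expn_gt0.
have -> : (2 ^ k.+1).-1 = (2 ^ k).-1 + (2 ^ k).-1.+1 by rewrite expnS; lia.
rewrite /mkseq iotaD map_cat add0n; congr (_ ++ _) => /=.
rewrite /ruler prednK // pfactorK //; congr (_ :: _).
rewrite -[X in iota X _]addn0 iotaDl -map_comp.
apply/eq_in_map => i; rewrite mem_iota add0n /= => i_lt; congr u.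
rewrite -addnS; apply: logn_addl_lt => //.
by rewrite pfactorK // ltnNge -pfactor_dvdn // gtnNdvd //; lia.
Qed.

Lemma toeplitz_prefix_ruler u k :
  toeplitz_prefix u (fun=> 2) k = mkseq (ruler u) (2 ^ k).-1.
Proof. by elim: k => // k IHk; rewrite ruler_mkseqS /= /spaced /= IHk. Qed.

Lemma spacedD l (p : seq L) j k : 0 < j -> 0 < k ->
  spaced l (j + k) p = spaced l j p ++ l :: spaced l k p.
Proof.
case: j => // j _; case: k => // k _; rewrite /spaced addSn addnS /=.
by elim: j => //= j ->; rewrite -catA.
Qed.

(** Each further step with the same letter [l] doubles the number of blocks. *)
Lemma toeplitz_prefix_run u l k d : (forall i, k <= i < k + d -> u i = l) ->
  spaced l (2 ^ d) (toeplitz_prefix u (fun=> 2) k) =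
  toeplitz_prefix u (fun=> 2) (k + d).
Proof.
elim: d => [|d IHd] ul; first by rewrite addn0.
rewrite addnS /= expnS mul2n -addnn spacedD ?expn_gt0 // /spaced /= ul; last lia.
by rewrite -/(spaced _ _ _) IHd // => i ?; apply: ul; lia.
Qed.

Lemma eventually_eventual (a : nat -> L) :
  exists N, forall k, N <= k -> a k \in eventual_alphabet a.
Proof.
have bound l : exists N, l \notin eventual_alphabet a -> forall k, N <= k -> a k <> l.
  have [le|ne] := boolP (l \in eventual_alphabet a); first by exists 0.
  have [N hN] : exists N, ~ exists2 k, N <= k & a k = l.
    by apply/existsNP => h; move/negP: ne; apply; apply/asboolP.
  by exists N => _ k Nk e; apply: hN; exists k.
have [N hN] := choice bound.
exists (\max_l N l) => k Nk; apply: contraT => /hN /(_ k) /(_ _ erefl) [].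
exact: leq_trans (leq_bigmax _) Nk.
Qed.

Lemma ruler_simple_toeplitz u : (forall N, exists k, N < k /\ u k <> u N) ->
  simple_toeplitz (subshift_of (ruler u)).
Proof.
move=> u_var.
have ex N : exists k, (N < k) && (u k != u N).
  by have [k [Nk /eqP uk]] := u_var N; exists k; rewrite Nk.
pose next N := ex_minn (ex N).
have nextP N : [/\ N < next N, u (next N) <> u N
                 & forall i, N <= i < next N -> u i = u N].
  rewrite /next; case: ex_minnP => k /andP[Nk /eqP uk] k_min; split=> // i.
  case/andP; rewrite leq_eqVlt => /predU1P[-> //|Ni] ik; apply/eqP.
  by apply: contraTT ik => ui; rewrite -leqNgt k_min // Ni.
(* [e j] is the start of the [j]-th maximal run of equal letters, counted from 0. *)
pose e j := iter j next 0.
pose a j := u (e j); pose n j := 2 ^ (e j.+1 - e j).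
have e_lt j : e j < e j.+1 by case: (nextP (e j)).
have e_ge j : j <= e j by elim: j => // j IHj; apply: leq_ltn_trans IHj (e_lt j).
have a_neq k : a k.+1 <> a k by case: (nextP (e k)).
have prefixE j : toeplitz_prefix a n j = toeplitz_prefix u (fun=> 2) (e j).
  elim: j => // j IHj; rewrite [LHS]/= IHj.
  rewrite toeplitz_prefix_run ?subnKC ?(ltnW (e_lt j)) //.
  by case: (nextP (e j)).
exists a, n; split; first split=> //.
- by move=> k; rewrite /n (@leq_exp2l 2 1) // subn_gt0.
- have [N hN] := eventually_eventual a.
  apply/card_gt1P; exists (a N), (a N.+1); split; try exact: hN.
  by apply/eqP => /esym/a_neq.
congr subshift_of; apply: funext => i.
rewrite /toeplitz_word prefixE toeplitz_prefix_ruler nth_mkseq //.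
have := ltn_expl (e i.+1) (isT : 1 < 2); have := e_ge i.+1; lia.
Qed.

(** * Aperiodicity of ruler subshifts *)

Lemma iter_shift T (omega : int -> T) k z :
  iter k (@shift T) omega z = omega (z + Posz k)%R.
Proof.
elim: k z => [|k IHk] z; first by rewrite addr0.
by rewrite iterS /shift IHk; congr omega; lia.
Qed.

Lemma logn2_window p t : exists2 i, i < 2 ^ t.+2 & logn 2 (p + i).+1 = t.
Proof.
(* An odd multiple of [2 ^ t], half a period after the first multiple of [2 ^ t.+1] beyond [p];
   hence [j - p <= 3 * 2 ^ t]. *)
pose j := (p %/ 2 ^ t.+1).+1 * 2 ^ t.+1 + 2 ^ t.
have t0 : 0 < 2 ^ t by rewrite expn_gt0.
have pE := divn_eq p (2 ^ t.+1).
have p_lt : p %% 2 ^ t.+1 < 2 ^ t.+1 by rewrite ltn_mod expn_gt0.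
have tS : 2 ^ t.+1 = 2 * 2 ^ t by rewrite expnS.
have tSS : 2 ^ t.+2 = 4 * 2 ^ t by rewrite !expnS mulnA.
exists (j - p).-1; first by rewrite /j mulSn; lia.
have -> : (p + (j - p).-1).+1 = j by rewrite /j mulSn; lia.
rewrite /j logn_addl_lt ?muln_gt0 ?expn_gt0 // !pfactorK //.
by rewrite lognM ?expn_gt0 // pfactorK //; lia.
Qed.

Lemma ruler_aperiodic u : (forall N, exists k, N < k /\ u k <> u N) ->
  aperiodic (subshift_of (ruler u)).
Proof.
move=> u_var [omega [P [om P0 per]]].
have [t [tP]] := u_var (logn 2 P); apply.
(* The window has room for a place of valuation [t] and its translate by [P], where the valuation
   drops to [logn 2 P]. *)
have := om (mkseq (fun i => omega (Posz i)) (2 ^ t.+2 + P)).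
case=> [|p]; rewrite ?size_mkseq.
  by exists 0%R; rewrite size_mkseq; apply: eq_mkseq => i; rewrite add0r.
move=> E.
have omE i : i < 2 ^ t.+2 + P -> omega (Posz i) = ruler u (p + i).
  move=> i_lt; have := congr1 (fun s => nth (u 0) s i) E.
  by rewrite !nth_mkseq.
have [i i_lt it] := logn2_window p t.
have := omE (i + P); rewrite ltn_add2r => /(_ i_lt).
have -> : omega (Posz (i + P)) = omega (Posz i).
  by rewrite -[in RHS]per iter_shift; congr omega; lia.
rewrite (omE i (ltn_addr _ i_lt)) /ruler it => ->; congr u.
by rewrite addnA -addSn logn_addl_lt // it.
Qed.

End Ruler.

(** * The complemented Gray code *)

Section Gray.

Definition flip k (x : nat -> bool) : nat -> bool := fun j => x j (+) (j == k).

(** The usual Gray code adds the bits [k] and [k + 1] of [i] modulo 2; [==] complements this sum, so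
    that [gray 0] is the ray of ones. *)
Fixpoint gray (i k : nat) : bool :=
  if k is k'.+1 then gray i./2 k' else odd i == odd i./2.

Lemma flipK k : involutive (flip k).
Proof. by move=> x; apply: funext => j; rewrite /flip -addbA addbb addbF. Qed.

Lemma flip_neq k x : flip k x <> x.
Proof. by move/(congr1 (@^~ k)); rewrite /flip eqxx; case: (x k). Qed.

Lemma flip_inj x j k : flip j x = flip k x -> j = k.
Proof.
move/(congr1 (@^~ j)); rewrite /flip eqxx => e; apply/eqP.
by move: e; case: (j == k) => //; case: (x j).
Qed.

Lemma logn2_even i : ~~ odd i -> logn 2 i.+1 = 0.
Proof. by move=> ev; apply/eqP; rewrite logn_coprime // coprime2n /= ev. Qed.

Lemma logn2_odd i : odd i -> logn 2 i.+1 = (logn 2 i./2.+1).+1.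
Proof.
move=> od; have -> : i.+1 = 2 * i./2.+1 by lia.
by rewrite lognM // logn_prime.
Qed.

(** For even [i] only the last bit changes, which flips the first letter. For odd [i] the parities
    of [i] and [i./2] both change, so the first letter stays and the carry passes to [i./2]. *)
Lemma grayS i : gray i.+1 = flip (logn 2 i.+1) (gray i).
Proof.
apply: funext => k; elim: k i => [|k IHk] i; rewrite /flip.
  have [od|ev] := boolP (odd i).
    rewrite logn2_odd //= uphalf_half od /=; by case: (odd _).
  by rewrite logn2_even //= uphalf_half (negbTE ev) /=; case: (odd _).
have [od|ev] := boolP (odd i); last first.
  by rewrite logn2_even //= uphalf_half (negbTE ev) /= addbF.
by rewrite /= uphalf_half od logn2_odd // add1n IHk.
Qed.

Lemma gray0 : gray 0 = ones.
Proof. by apply: funext; elim. Qed.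

(** Puts the first 0 right before the letter that the next step flips, the only letter that an
    [aut_b] can change. *)
Lemma gray_first_false i : odd i ->
  (forall j, j < logn 2 i./2.+1 -> gray i j) /\ gray i (logn 2 i./2.+1) = false.
Proof.
elim/ltn_ind: i => i IHi od.
have [od'|ev] := boolP (odd i./2); last first.
  by rewrite logn2_even //= od (negbTE ev).
rewrite logn2_odd //=; have [|h1 h2] := IHi i./2 _ od'; first lia.
split=> // -[|j] /= j_lt; first by rewrite od od'.
exact: h1.
Qed.

End Gray.

(** * Generators acting on the boundary *)

Section BoundaryAction.
Local Open Scope ring_scope.
Variable m : nat.
Implicit Types (xi : nat -> Epi m) (b : 'rV['Z_2]_m) (x : nat -> bool).

Lemma mkseqSl T (f : nat -> T) k : mkseq f k.+1 = f 0%N :: mkseq (fun i => f i.+1) k.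
Proof. by rewrite /mkseq /= (iotaDl 1 0) -map_comp. Qed.

Lemma bd_act_a x : bd_act aut_a x = flip 0 x.
Proof.
apply: funext => k; rewrite /bd_act mkseqSl /flip.
case: k => [|k] /=; first by rewrite addbT.
by rewrite nth_mkseq // addbF.
Qed.

Lemma Z2_cases (c : 'Z_2) : c = 0 \/ c = 1.
Proof. by case: c => -[|[|//]] ?; [left|right]; apply: val_inj. Qed.

Lemma bd_act_b0 xi b x : bd_act (aut_b xi b) x 0%N = x 0%N.
Proof. by rewrite /bd_act /=; case: (x 0%N). Qed.

(** The induction strips leading 1s and shifts [xi]; past the 0, [a] flips the next letter, hence
    [r.+1]. *)
Lemma bd_act_b xi b x r : (forall j, (j < r)%N -> x j) -> x r = false ->
  bd_act (aut_b xi b) x = if xi r b == 0 then x else flip r.+1 x.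
Proof.
elim: r xi x => [|r IHr] xi x xT xF; apply: funext => -[|k].
- by rewrite bd_act_b0; case: ifP => // _; rewrite /flip addbF.
- rewrite /bd_act mkseqSl xF /=.
  have [->|->] := Z2_cases (xi 0%N b); first by rewrite eqxx /= nth_mkseq.
  have := congr1 (@^~ k) (bd_act_a (fun i => x i.+1)).
  by rewrite /bd_act /= => ->.
- by rewrite bd_act_b0; case: ifP => // _; rewrite /flip addbF.
- rewrite /bd_act mkseqSl xT //=.
  have := congr1 (@^~ k) (IHr (fun i => xi i.+1) (fun i => x i.+1) _ xF).
  by rewrite /bd_act => -> => [|j jr]; [case: ifP | apply: xT].
Qed.

(** The two points differ only beyond their common first 0, so each [aut_b] fixes both or swaps
    them. *)
Lemma bd_act_b_gray xi b i : odd i ->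
  let z := xi (logn 2 i./2.+1) b == 0 in
  bd_act (aut_b xi b) (gray i) = (if z then gray i else gray i.+1) /\
  bd_act (aut_b xi b) (gray i.+1) = (if z then gray i.+1 else gray i).
Proof.
move=> od; have [xT xF] := gray_first_false od.
have gS : gray i.+1 = flip (logn 2 i./2.+1).+1 (gray i) by rewrite grayS logn2_odd.
split; first by rewrite (bd_act_b _ _ xT xF) gS.
rewrite (@bd_act_b _ _ _ (logn 2 i./2.+1)) gS ?flipK //.
- by move=> j j_lt; rewrite /flip ltn_eqF ?addbF ?xT // ltnW.
- by rewrite /flip ltn_eqF ?addbF.
Qed.

Lemma mkseq_bd_act g x k : tree_aut g -> mkseq (bd_act g x) k = g (mkseq x k).
Proof.
move=> [_ sz tk]; apply: (@eq_from_nth _ false).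
  by rewrite sz !size_mkseq.
rewrite size_mkseq => i ik; rewrite nth_mkseq // /bd_act.
have -> : mkseq x i.+1 = take i.+1 (mkseq x k).
  by rewrite /mkseq -map_take take_iota (minn_idPl ik).
by rewrite tk nth_take.
Qed.

Lemma bd_act_comp g h x : tree_aut h -> bd_act (g \o h) x = bd_act g (bd_act h x).
Proof. by move=> th; apply: funext => k; rewrite /bd_act /= -mkseq_bd_act. Qed.

Lemma epiD (phi : Epi m) (x y : 'rV['Z_2]_m) : phi (x + y) = phi x + phi y.
Proof. by have /andP[/forallP/(_ x)/forallP/(_ y)/eqP] := valP phi. Qed.

Lemma epi_surj (phi : Epi m) c : exists b, phi b = c.
Proof. by have /andP[_ /forallP/(_ c)/existsP[b /eqP]] := valP phi; exists b. Qed.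

Lemma epi_ker_inj (phi psi : Epi m) :
  (forall b, phi b = 0 <-> psi b = 0) -> phi = psi.
Proof.
move=> ker; apply: val_inj; apply/ffunP => b; rewrite -!/(epi_fun _ b).
have := ker b; case: (Z2_cases (phi b)) => ->; case: (Z2_cases (psi b)) => -> //.
  by case=> /(_ erefl).
by case=> _ /(_ erefl).
Qed.

(** If neither of two basis vectors is in the kernel, both have value 1 and their sum is in it. *)
Lemma epi_ker_neq0 (phi : Epi m) : (2 <= m)%N -> exists2 b, b <> 0 & phi b = 0.
Proof.
move=> m2.
pose e (i : 'I_m) : 'rV['Z_2]_m := delta_mx 0 i.
pose i0 : 'I_m := Ordinal (ltnW m2); pose i1 : 'I_m := Ordinal m2.
have ne (b : 'rV['Z_2]_m) i : b 0 i <> 0 -> b <> 0 by move=> h b0; rewrite b0 mxE in h.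
have [z0|n0] := Z2_cases (phi (e i0)).
  by exists (e i0) => //; apply: (@ne _ i0); rewrite mxE !eqxx.
have [z1|n1] := Z2_cases (phi (e i1)).
  by exists (e i1) => //; apply: (@ne _ i1); rewrite mxE !eqxx.
exists (e i0 + e i1); first by apply: (@ne _ i0); rewrite !mxE.
by rewrite epiD n0 n1; apply: val_inj.
Qed.

(** * The Schreier ray and its word *)

Definition spinal_letter xi k : letter m := if k is r.+1 then Some (xi r) else None.

Lemma spinal_letter_var xi : (2 <= m)%N -> Xi xi ->
  forall N, exists k, (N < k)%N /\ spinal_letter xi k <> spinal_letter xi N.
Proof.
move=> m2 hxi [|r]; first by exists 1%N.
(* If all later letters equal [Some (xi r)], a nonzero element of the kernel of [xi r] lies in every
   later kernel, against [Xi]. *)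
apply: contrapT => const; have [b b0 bker] := epi_ker_neq0 (xi r) m2.
apply: b0; have : [set 0]%classic b; last by [].
rewrite -(hxi r) => j /=; rewrite leq_eqVlt => /predU1P[<- //|rj].
suff -> : xi j = xi r by [].
by apply: contrapT => ne; apply: const; exists j.+1; split=> // -[].
Qed.

Lemma gray_edge xi i :
  exists2 s, spinal_gens xi s & gray i.+1 = bd_act s (gray i).
Proof.
have [od|ev] := boolP (odd i); last first.
  by exists aut_a; [left | rewrite bd_act_a grayS logn2_even].
have [b hb] := epi_surj (xi (logn 2 i./2.+1)) 1.
have [act _] := bd_act_b_gray xi b od; rewrite hb /= in act.
exists (aut_b xi b) => //; right; split; first by exists b.
move=> bid; apply: (@flip_neq (logn 2 i.+1) (gray i)); rewrite -grayS -act bid.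
by apply: funext => k; rewrite /bd_act nth_mkseq.
Qed.

Lemma spinal_gens_group xi : (spinal_gens xi `<=` spinal_group xi)%classic.
Proof. by move=> s [sa|[sb _]]; apply: generated_in; [left|right]. Qed.

Lemma gray_orbit xi i : orbit_ones xi (gray i).
Proof.
elim: i => [|i [g Gg gE]].
  exists id; first exact: generated_id.
  by rewrite gray0; apply: funext => k; rewrite /bd_act nth_mkseq.
have [s Ss ->] := gray_edge xi i; exists (s \o g).
  by apply: generated_comp Gg; apply: spinal_gens_group.
by rewrite bd_act_comp -?gE //; apply: spinal_group_tree_aut Gg.
Qed.

(** One of the two kinds of generators can only lead back, the other only on; the parity of [i]
    decides which, and an [aut_b] may also give a loop. *)
Lemma gray_neighbour xi i y : neighbour xi (gray i.+1) y ->
  [\/ y = gray i, y = gray i.+1 | y = gray i.+2].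
Proof.
case=> s [_ Ss ->]; have [od|ev] := boolP (odd i).
  case: Ss => [->|[[b _ <-] _]].
    by constructor 3; rewrite bd_act_a (grayS i.+1) logn2_even //= od.
  have [_ ->] := bd_act_b_gray xi b od.
  by case: ifP => _; [constructor 2 | constructor 1].
case: Ss => [->|[[b _ <-] _]].
  by constructor 1; rewrite bd_act_a grayS logn2_even // flipK.
have [-> _] := bd_act_b_gray xi b (ev : odd i.+1).
by case: ifP => _; [constructor 2 | constructor 3].
Qed.

Lemma gray_schreier_ray xi : schreier_ray xi gray.
Proof.
split; [exact: gray0 | by rewrite bd_act_a grayS |].
move=> i y; split=> [->|[/gray_neighbour[] -> //]]; split.
- have [s Ss yE] := gray_edge xi i.+1; exists s; split=> //; exact: gray_orbit.
- by rewrite grayS; apply: flip_neq.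
(* Consecutive steps flip different letters, since exactly one of [i.+1] and [i.+2] has valuation
   0. *)
- rewrite grayS -[X in _ <> X](flipK (logn 2 i.+1)) -(grayS i) => /flip_inj.
  have [od|ev] := boolP (odd i); last by rewrite (logn2_even ev) logn2_odd.
  by rewrite (logn2_odd od) logn2_even //= od.
Qed.

Lemma schreier_word_ruler xi : schreier_word xi (ruler (spinal_letter xi)).
Proof.
exists gray; first exact: gray_schreier_ray.
move=> i; rewrite /ruler bd_act_a grayS.
have [od|ev] := boolP (odd i).
  rewrite logn2_odd //=; split; first by split=> // /flip_inj.
  have setE : [set b | bd_act (aut_b xi b) (gray i) =
      flip (logn 2 i./2.+1).+1 (gray i)]%classic =
      (~` [set b | xi (logn 2 i./2.+1) b = 0])%classic.
    apply/seteqP; split=> b /=; have [-> _] := bd_act_b_gray xi b od.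
      by case: eqP => // _ /esym/flip_neq.
    by case: eqP => // _ _; rewrite grayS logn2_odd.
  move=> phi; split=> [[<-] //|]; rewrite setE => /setC_inj ker.
  congr Some; apply: epi_ker_inj => b.
  by have := congr1 (@^~ b) ker => /= ->.
(* Here the first letter changes, which no [aut_b] achieves, while the complement of the kernel of
   [phi] is nonempty. *)
rewrite logn2_even //; split=> // phi; split=> // ker.
have [b hb] := epi_surj phi 1.
have : (~` [set b | phi b = 0])%classic b by rewrite /= hb.
rewrite -ker /= => /(congr1 (@^~ 0%N)); rewrite bd_act_b0 /flip /=.
by case: (_ == _).
Qed.

Lemma spinal_wordE xi : spinal_word xi = ruler (spinal_letter xi).
Proof.
apply: (@schreier_word_uniq m xi); last exact: schreier_word_ruler.
(* A Schreier word exists, so [xget] does not return its default. *)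
exact: xgetPex (ex_intro _ _ (schreier_word_ruler xi)).
Qed.

End BoundaryAction.

Theorem theorem7p1 (m : nat) (xi : nat -> Epi m)
    (hm : (2 <= m)%N) (hxi : Xi xi) :
  simple_toeplitz (spinal_subshift xi) /\ aperiodic (spinal_subshift xi).
Proof.
have u_var := spinal_letter_var hm hxi.
rewrite /spinal_subshift spinal_wordE; split.
  exact: ruler_simple_toeplitz.
exact: ruler_aperiodic.
Qed.
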